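(* Suppose that $M$ is a faithful module over a commutative ring $R$. Let $S=R-Zd(M)$, $q(R)=S^{-1}R$ and $q(M)=S^{-1}M$. The following statements are equivalent: (i) $M$ is a regular fusible $R$-module. (ii) $q(M)$ is a fusible $q(R)$-module. (iii) $q(M)$ is a regular fusible $q(R)$-module.
   Context: Rings have an identity. $M$ is faithful if $\{r\in R: Mr=0\}=0$. For a module $M$ over a ring $R$ and $m\in M$, $ann_R(m)=\{r\in R: mr=0\}$; $T_R(M)=\{m\in M: ann_R(m)\neq 0\}$ is the set of torsion elements, $T_R^{\star}(M)=\{m\in M: ann_R(m)=0\}$ the set of torsion free elements, and $Zd(M)=\{r\in R: mr=0\text{ for some }0\neq m\in M\}$. The set $R-Zd(M)$ is multiplicatively closed, and the $S^{-1}R$-module $S^{-1}M$ for $S=R-Zd(M)$ is called the total quotient module. An element of $M$ is fusible if it can be written as $x+y$ with $x\in T_R(M)$ and $y\in T_R^{\star}(M)$; $M$ is fusible if every nonzero element of $M$ is fusible. A nonzero $m\in M$ is regular fusible if there exists $r\in R-Zd(M)$ such that $mr$ is fusible; $M$ is regular fusible if every nonzero element of $M$ is regular fusible. The same definitions apply to $q(M)$ over $q(R)$. *)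

(* Defs.v *)
From HB Require Import structures.
From mathcomp Require Import all_boot all_order all_algebra generic_quotient.
From mathcomp Require Import ring.
From mathcomp Require Import boolp classical_sets.

Set Implicit Arguments.
Unset Strict Implicit.
Unset Printing Implicit Defensive.

Import GRing.Theory.
Local Open Scope classical_set_scope.
Local Open Scope ring_scope.
Local Open Scope quotient_scope.

(* Rings have an identity but may be trivial (comPzRingType).  Over a
   commutative ring, left and right modules agree; the product of m in M by
   r in R is written r *: m. *)
Section Torsion.
Variables (R : comPzRingType) (M : lmodType R).

Definition faithful : Prop := [set r : R | forall m : M, r *: m = 0] = [set 0].

Definition ann (m : M) : set R := [set r | r *: m = 0].

Definition torsion : set M := [set m | ann m <> [set 0]].

Definition torsion_free : set M := [set m | ann m = [set 0]].

Definition Zd : set R := [set r | exists2 m : M, m != 0 & r *: m = 0].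

Definition fusible_elt (m : M) : Prop :=
  exists x y : M, [/\ torsion x, torsion_free y & m = x + y].

Definition fusible : Prop := forall m : M, m != 0 -> fusible_elt m.

Definition regular_fusible_elt (m : M) : Prop :=
  exists2 r : R, ~ Zd r & fusible_elt (r *: m).

Definition regular_fusible : Prop :=
  forall m : M, m != 0 -> regular_fusible_elt m.

Definition nonZd : {pred R} := fun r => `[< ~ Zd r >].

Lemma nonZdP (r : R) : reflect (~ Zd r) (r \in nonZd).
Proof. exact: asboolP. Qed.

Lemma nonZd_mulr_closed : mulr_closed nonZd.
Proof.
split.
  by apply/nonZdP => -[m m0]; rewrite scale1r => mE; rewrite mE eqxx in m0.
move=> r s /nonZdP rS /nonZdP sS; apply/nonZdP => -[m m0]; rewrite -scalerA.
have [sm0 _|sm0 rsm0] := eqVneq (s *: m) 0; first by apply: sS; exists m.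
by apply: rS; exists (s *: m).
Qed.

HB.instance Definition _ := GRing.isMulClosed.Build R nonZd nonZd_mulr_closed.

End Torsion.

Arguments faithful {R} M.
Arguments Zd {R} M.
Arguments fusible {R} M.
Arguments regular_fusible {R} M.
Arguments nonZd {R} M.

Section Denominators.
Variables (R : comPzRingType) (S : mulrClosed R).

Definition denom : Type := {s : R | s \in (S : {pred R})}.
HB.instance Definition _ := Choice.on denom.

Definition denom1 : denom := exist _ 1 (@rpred1 R S).
Definition denomM (s t : denom) : denom :=
  exist _ (sval s * sval t) (@rpredM R S (sval s) (sval t) (valP s) (valP t)).

End Denominators.

Arguments denom1 {R S}.

Section ModuleLocalization.
Variables (R : comPzRingType) (S : mulrClosed R) (M : lmodType R).
Local Notation denom := (denom S).

(* (m, s) ~ (n, t) iff u (t m) = u (s n) for some u in S. *)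
Definition frac_equiv (x y : M * denom) : bool :=
  `[< exists u : denom,
        sval u *: (sval y.2 *: x.1) = sval u *: (sval x.2 *: y.1) >].

Lemma frac_equiv_is_equiv : equiv_class_of frac_equiv.
Proof.
split.
- by move=> x; apply/asboolP; exists denom1.
- by move=> x y; apply/asboolP/asboolP => -[u uE]; exists u.
move=> [n t] [m s] [p v] /asboolP[u /= E] /asboolP[w /= E'].
apply/asboolP; exists (denomM t (denomM u w)) => /=.
transitivity ((sval w * sval v) *: (sval u *: (sval t *: m))).
  by rewrite !scalerA; congr (_ *: _); ring.
rewrite E.
transitivity ((sval u * sval s) *: (sval w *: (sval v *: n))).
  by rewrite !scalerA; congr (_ *: _); ring.
by rewrite E' !scalerA; congr (_ *: _); ring.
Qed.

Canonical frac_equiv_equiv := EquivRelPack frac_equiv_is_equiv.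

(* S^{-1} M *)
Definition modloc : Type := {eq_quot frac_equiv}.
HB.instance Definition _ := Choice.on modloc.

Definition mfrac (m : M) (s : denom) : modloc :=
  \pi_({eq_quot frac_equiv}) (m, s).

Lemma mfracP (x : modloc) : exists m s, x = mfrac m s.
Proof.
by exists (repr x).1, (repr x).2; rewrite /mfrac -surjective_pairing reprK.
Qed.

Lemma mfrac_eqP m s n t :
  mfrac m s = mfrac n t <->
  exists u : denom, sval u *: (sval t *: m) = sval u *: (sval s *: n).
Proof. by split=> [/eqmodP/asboolP|E]; last exact/eqmodP/asboolP. Qed.

Lemma mfrac_eq m s n t : sval t *: m = sval s *: n -> mfrac m s = mfrac n t.
Proof. by move=> E; apply/mfrac_eqP; exists denom1; rewrite E. Qed.

Definition modloc_add (x y : modloc) : modloc :=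
  mfrac (sval (repr y).2 *: (repr x).1 + sval (repr x).2 *: (repr y).1)
       (denomM (repr x).2 (repr y).2).

Definition modloc_opp (x : modloc) : modloc := mfrac (- (repr x).1) (repr x).2.

Lemma repr_mfrac m s :
  exists u : denom, sval u *: (sval s *: (repr (mfrac m s)).1) =
                    sval u *: (sval (repr (mfrac m s)).2 *: m).
Proof. by apply/mfrac_eqP; rewrite /mfrac -surjective_pairing reprK. Qed.

Lemma modloc_addE m s n t :
  modloc_add (mfrac m s) (mfrac n t) =
  mfrac (sval t *: m + sval s *: n) (denomM s t).
Proof.
rewrite /modloc_add; have [u] := repr_mfrac m s; have [w] := repr_mfrac n t.
move: (repr _) (repr _) => [m' s'] [n' t'] /= En Em.
apply/mfrac_eqP; exists (denomM u w) => /=.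
transitivity ((sval w * sval t * sval t') *: (sval u *: (sval s *: m')) +
              (sval u * sval s * sval s') *: (sval w *: (sval t *: n'))).
  by rewrite !(scalerDr, scalerA); congr (_ *: _ + _ *: _); ring.
rewrite Em En.
by rewrite !(scalerDr, scalerA); congr (_ *: _ + _ *: _); ring.
Qed.

Lemma modloc_oppE m s : modloc_opp (mfrac m s) = mfrac (- m) s.
Proof.
rewrite /modloc_opp; have [u] := repr_mfrac m s.
move: (repr _) => [m' s'] /= E.
by apply/mfrac_eqP; exists u => /=; rewrite !scalerN E.
Qed.

Lemma modloc_addA : associative modloc_add.
Proof.
move=> x y z; have [m [s ->]] := mfracP x; have [n [t ->]] := mfracP y.
have [p [v ->]] := mfracP z; rewrite !modloc_addE; apply: mfrac_eq => /=.
rewrite !(scalerDr, scalerA) -!addrA.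
by congr (_ *: _ + (_ *: _ + _ *: _)); ring.
Qed.

Lemma modloc_addC : commutative modloc_add.
Proof.
move=> x y; have [m [s ->]] := mfracP x; have [n [t ->]] := mfracP y.
by rewrite !modloc_addE addrC; congr mfrac; apply: val_inj; rewrite /= mulrC.
Qed.

Lemma modloc_add0 : left_id (mfrac 0 denom1) modloc_add.
Proof.
move=> x; have [m [s ->]] := mfracP x; rewrite modloc_addE.
by apply: mfrac_eq; rewrite /= scaler0 add0r scale1r mul1r.
Qed.

Lemma modloc_addN : left_inverse (mfrac 0 denom1) modloc_opp modloc_add.
Proof.
move=> x; have [m [s ->]] := mfracP x; rewrite modloc_oppE modloc_addE.
by apply: mfrac_eq; rewrite /= scalerN addNr !scaler0.
Qed.

HB.instance Definition _ := GRing.isZmodule.Build modloc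
  modloc_addA modloc_addC modloc_add0 modloc_addN.

Lemma mfrac0E : mfrac 0 denom1 = 0. Proof. by []. Qed.

Lemma mfracD m s n t :
  mfrac m s + mfrac n t = mfrac (sval t *: m + sval s *: n) (denomM s t).
Proof. exact: modloc_addE. Qed.

End ModuleLocalization.

Section RingLocalization.
Variables (R : comPzRingType) (S : mulrClosed R).

(* S^{-1} R: additively, this is the localization of R as a module over
   itself. *)
Definition ringloc : Type := modloc S R^o.
HB.instance Definition _ := GRing.Zmodule.on ringloc.

Definition rfrac (r : R) (s : denom S) : ringloc := mfrac (r : R^o) s.

Lemma rfracP (x : ringloc) : exists r s, x = rfrac r s.
Proof. exact: (@mfracP R S R^o). Qed.

Lemma rfrac_eqP r s r' s' :
  rfrac r s = rfrac r' s' <->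
  exists u : denom S, sval u * (sval s' * r) = sval u * (sval s * r').
Proof. exact: (@mfrac_eqP R S R^o). Qed.

Lemma rfrac0E : rfrac 0 denom1 = 0. Proof. by []. Qed.

Lemma rfracD r s r' s' :
  rfrac r s + rfrac r' s' = rfrac (sval s' * r + sval s * r') (denomM s s').
Proof. exact: (@mfracD R S R^o). Qed.

Section Scale.
Variable M : lmodType R.

Definition modloc_scale (a : ringloc) (x : modloc S M) : modloc S M :=
  mfrac (((repr a).1 : R) *: (repr x).1) (denomM (repr a).2 (repr x).2).

Lemma modloc_scaleE r s m t :
  modloc_scale (rfrac r s) (mfrac m t) = mfrac (r *: m) (denomM s t).
Proof.
rewrite /modloc_scale /rfrac.
have [u] := repr_mfrac (r : R^o) s; have [w] := repr_mfrac m t.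
move: (repr _) (repr _) => [r' s'] [m' t'] /= Em.
rewrite /GRing.scale /= => Er.
apply/mfrac_eqP; exists (denomM u w) => /=.
transitivity ((sval u * (sval s * r')) *: (sval w *: (sval t *: m'))).
  by rewrite !scalerA; congr (_ *: _); ring.
by rewrite Er Em !scalerA; congr (_ *: _); ring.
Qed.

Lemma modloc_scaleDr : right_distributive modloc_scale +%R.
Proof.
move=> a x y; have [r [s ->]] := rfracP a; have [m [t ->]] := mfracP x.
have [n [v ->]] := mfracP y; rewrite !(mfracD, modloc_scaleE).
apply: mfrac_eq => /=; rewrite !(scalerDr, scalerA).
by congr (_ *: _ + _ *: _); ring.
Qed.

Lemma modloc_scaleDl x : {morph modloc_scale^~ x : a b / a + b}.
Proof.
move=> a b; have [r [s ->]] := rfracP a; have [r' [s' ->]] := rfracP b.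
have [m [t ->]] := mfracP x; rewrite !(rfracD, mfracD, modloc_scaleE).
apply: mfrac_eq => /=; rewrite !(scalerDr, scalerDl, scalerA) -scalerDl.
by rewrite -scalerDl; congr (_ *: _); ring.
Qed.

Lemma modloc_scale1 : left_id (rfrac 1 denom1) modloc_scale.
Proof.
move=> x; have [m [t ->]] := mfracP x; rewrite modloc_scaleE.
by apply: mfrac_eq; rewrite /= scale1r mul1r.
Qed.

End Scale.

Definition ringloc_mul (a b : ringloc) : ringloc := @modloc_scale R^o a b.

Lemma ringloc_mulE r s r' s' :
  ringloc_mul (rfrac r s) (rfrac r' s') = rfrac (r * r') (denomM s s').
Proof. exact: (@modloc_scaleE R^o). Qed.

Lemma modloc_scaleA (M : lmodType R) (a b : ringloc) (x : modloc S M) :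
  modloc_scale a (modloc_scale b x) = modloc_scale (ringloc_mul a b) x.
Proof.
have [r [s ->]] := rfracP a; have [r' [s' ->]] := rfracP b.
have [m [t ->]] := mfracP x; rewrite ringloc_mulE !modloc_scaleE scalerA.
by congr mfrac; apply: val_inj; rewrite /= mulrA.
Qed.

Lemma ringloc_mulA : associative ringloc_mul.
Proof. by move=> a b c; apply: (@modloc_scaleA R^o). Qed.

Lemma ringloc_mulC : commutative ringloc_mul.
Proof.
move=> a b; have [r [s ->]] := rfracP a; have [r' [s' ->]] := rfracP b.
rewrite !ringloc_mulE mulrC; congr rfrac.
by apply: val_inj; rewrite /= mulrC.
Qed.

Lemma ringloc_mul1 : left_id (rfrac 1 denom1) ringloc_mul.
Proof. exact: (@modloc_scale1 R^o). Qed.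

Lemma ringloc_mulDl : left_distributive ringloc_mul +%R.
Proof. by move=> a b c; apply: (@modloc_scaleDl R^o). Qed.

HB.instance Definition _ := GRing.Zmodule_isComPzRing.Build ringloc
  ringloc_mulA ringloc_mulC ringloc_mul1 ringloc_mulDl.

Lemma rfrac1E : rfrac 1 denom1 = 1. Proof. by []. Qed.

Lemma rfracM r s r' s' :
  rfrac r s * rfrac r' s' = rfrac (r * r') (denomM s s').
Proof. exact: ringloc_mulE. Qed.

End RingLocalization.

HB.instance Definition _ (R : comPzRingType) (S : mulrClosed R)
    (M : lmodType R) :=
  GRing.Zmodule_isLmodule.Build (ringloc S) (modloc S M)
    (@modloc_scaleA R S M) (@modloc_scale1 R S M)
    (@modloc_scaleDr R S M) (@modloc_scaleDl R S M).

Lemma mfracZ (R : comPzRingType) (S : mulrClosed R) (M : lmodType R)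
    r s (m : M) t :
  rfrac (S := S) r s *: mfrac m t = mfrac (r *: m) (denomM s t).
Proof. exact: modloc_scaleE. Qed.

(* q(R) and q(M): both R and M are localized at R - Zd(M). *)
Definition total_quotient_ring (R : comPzRingType) (M : lmodType R) :
  comPzRingType := ringloc (nonZd M).

Definition total_quotient_module (R : comPzRingType) (M : lmodType R) :
  lmodType (total_quotient_ring M) := modloc (nonZd M) M.

(* Main.v *)
Require Import Defs.
From mathcomp Require Import all_boot all_order all_algebra.
From mathcomp Require Import boolp classical_sets.

(** Write [S] for the complement of [Zd M].  The elements of [S] act injectively
    on [M] by definition, and, when [M] is faithful, they are regular in [R] as
    well: [s * r = 0] forces [s *: (r *: m) = 0], hence [r *: m = 0], for every
    [m].  So both localization maps are injective, numerators decide when a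
    fraction vanishes, and the proof rests on three facts.

    - A fraction [m / s] is torsion exactly when [m] is ([torsion_mfrac]), so a
      decomposition of [r *: m], with [r] in [S], passes to
      [m / s = (r *: m) / (r * s)].  Conversely a decomposition of [m / 1] with
      denominators [s] and [t] becomes one of [(s * t) *: m] in [M], because
      multiplying by [S] does not change annihilators ([ann_scale]).
      So [M] is regular fusible exactly when [q(M)] is fusible.

    - A fraction [r / s] is a non-zero-divisor on [q(M)] only if [r] lies in
      [S], and then it is invertible ([nonZd_total_quotient_inv]).

    - Fusible elements are stable under non-zero-divisors
      ([fusible_elt_scale]).  If [a *: x] is fusible in [q(M)], with [a] a
      non-zero-divisor, then so is [x = a^-1 *: (a *: x)]: regular fusible and
      fusible mean the same for [q(M)]. *)

Set Implicit Arguments.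
Unset Strict Implicit.
Unset Printing Implicit Defensive.

Import GRing.Theory.
Local Open Scope classical_set_scope.
Local Open Scope ring_scope.

Section NonZeroDivisors.
Variables (R : comPzRingType) (M : lmodType R).
Implicit Types (r s : R) (m : M).

Lemma nonZd_scale_eq0 s m : ~ Zd M s -> s *: m = 0 -> m = 0.
Proof. by move=> sS sm0; apply: contrapT => /eqP m0; apply: sS; exists m. Qed.

Lemma nonZd_scaleI s : ~ Zd M s -> injective (fun m => s *: m).
Proof.
move=> sS m n /eqP; rewrite -subr_eq0 -scalerBr => /eqP /(nonZd_scale_eq0 sS).
by move=> /eqP; rewrite subr_eq0 => /eqP.
Qed.

Lemma nonZd_inv s t : s * t = 1 -> ~ Zd M s.
Proof.
move=> st1 [m /eqP m0 sm0]; apply: m0.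
by rewrite -[m]scale1r -st1 mulrC -scalerA sm0 scaler0.
Qed.

Lemma nonZd1 : ~ Zd M 1.
Proof. by apply: (@nonZd_inv 1 1); rewrite mulr1. Qed.

Lemma faithful_nonZd_mul_eq0 s r :
  faithful M -> ~ Zd M s -> s * r = 0 -> r = 0.
Proof.
move=> hM sS sr0; suff: [set r | forall m : M, r *: m = 0] r by rewrite hM.
by move=> m; apply: (nonZd_scale_eq0 sS); rewrite scalerA sr0 scale0r.
Qed.

(** [r *: (s *: m) = s *: (r *: m)], and [s] acts injectively. *)
Lemma ann_scale s m : ~ Zd M s -> ann (s *: m) = ann m.
Proof.
move=> sS; apply/seteqP; split=> r; rewrite /ann /= scalerA mulrC -scalerA.
  exact: nonZd_scale_eq0.
by move=> ->; rewrite scaler0.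
Qed.

Lemma torsion_scale s m : ~ Zd M s -> torsion m -> torsion (s *: m).
Proof. by move=> sS; rewrite /torsion /= ann_scale. Qed.

Lemma torsion_free_scale s m :
  ~ Zd M s -> torsion_free m -> torsion_free (s *: m).
Proof. by move=> sS; rewrite /torsion_free /= ann_scale. Qed.

Lemma fusible_elt_scale s m : ~ Zd M s -> fusible_elt m -> fusible_elt (s *: m).
Proof.
move=> sS [x [y [xT yF ->]]]; exists (s *: x), (s *: y).
by rewrite scalerDr; split=> //; [exact: torsion_scale|exact: torsion_free_scale].
Qed.

Lemma fusible_regular_fusible : fusible M -> regular_fusible M.
Proof.
by move=> fM m m0; exists 1; [exact: nonZd1|rewrite scale1r; exact: fM].
Qed.

(** The hypothesis says that [R] is its own total quotient ring with respect
    to [M]. *)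
Lemma regular_fusible_fusible :
    (forall s, ~ Zd M s -> exists t, t * s = 1) ->
  regular_fusible M -> fusible M.
Proof.
move=> invS rfM m /rfM [s /invS [t ts1]] /(fusible_elt_scale (nonZd_inv ts1)).
by rewrite scalerA ts1 scale1r.
Qed.

End NonZeroDivisors.

Section TotalQuotient.
Variables (R : comPzRingType) (M : lmodType R).
Local Notation S := (nonZd M).
Local Notation qR := (total_quotient_ring M).
Local Notation qM := (total_quotient_module M).
Implicit Types (r : R) (m : M) (s t : denom S).

Lemma denom_nonZd s : ~ Zd M (sval s).
Proof. exact/nonZdP/(valP s). Qed.

Lemma mfrac_eq0 m s : mfrac m s = 0 <-> m = 0.
Proof.
rewrite -mfrac0E; split=> [/mfrac_eqP [u] /=|->].
  rewrite scale1r !scaler0; exact/nonZd_scale_eq0/denom_nonZd.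
by apply: mfrac_eq; rewrite !scaler0.
Qed.

Lemma nonZd_total_quotient_inv (a : qR) : ~ Zd qM a -> exists b, b * a = 1.
Proof.
have [r [s ->]] := rfracP a => aS.
have rS : r \in S.
  apply/nonZdP => -[m /eqP m0 rm0]; apply: aS.
  exists (mfrac m denom1); first by apply/eqP => /mfrac_eq0.
  by rewrite mfracZ rm0; apply/mfrac_eq0.
exists (rfrac (sval s) (exist _ r rS)).
rewrite rfracM -rfrac1E; apply/rfrac_eqP; exists denom1 => /=.
by rewrite !mul1r !mulr1 mulrC.
Qed.

Lemma mfrac_scale_cancel m s (r : denom S) :
  mfrac (sval r *: m) (denomM r s) = mfrac m s.
Proof. by apply: mfrac_eq; rewrite /= !scalerA mulrC. Qed.

Lemma mfrac_addl m n s : mfrac (m + n) s = mfrac m s + mfrac n s.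
Proof.
by rewrite mfracD -scalerDr; symmetry; exact: mfrac_scale_cancel.
Qed.

Section Faithful.
Hypothesis hM : faithful M.

Lemma rfrac_eq0 r s : rfrac r s = 0 :> qR <-> r = 0.
Proof.
rewrite -rfrac0E; split=> [/rfrac_eqP [u] /=|->].
  rewrite mul1r !mulr0; exact/(faithful_nonZd_mul_eq0 hM)/denom_nonZd.
by apply/rfrac_eqP; exists denom1; rewrite !mulr0.
Qed.

(** [(r / t) *: (m / s)] vanishes exactly when [r *: m] does, so the
    annihilator of [m / s] consists of the fractions with numerator in
    [ann m]. *)
Lemma torsion_free_mfrac m s :
  torsion_free (mfrac m s : qM) <-> torsion_free m.
Proof.
rewrite /torsion_free /ann /=; split=> /seteqP [annP _]; apply/seteqP.
  split=> [r /= rm0|_ ->]; last by rewrite /= scale0r.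
  apply/(rfrac_eq0 r denom1)/annP => /=.
  by rewrite mfracZ rm0; apply/mfrac_eq0.
split=> [a|_ -> /=]; last by rewrite scale0r.
have [r [t ->]] := rfracP a => /=; rewrite mfracZ => /mfrac_eq0 /annP /=.
by move=> r0; apply/rfrac_eq0.
Qed.

Lemma torsion_mfrac m s : torsion (mfrac m s : qM) <-> torsion m.
Proof. by split=> mT /(torsion_free_mfrac m s) /mT. Qed.

Lemma fusible_elt_mfrac m s : fusible_elt m -> fusible_elt (mfrac m s : qM).
Proof.
move=> [x [y [xT yF ->]]]; exists (mfrac x s), (mfrac y s).
split; [exact/torsion_mfrac|exact/torsion_free_mfrac|exact: mfrac_addl].
Qed.

Lemma fusible_elt_mfrac_regular m s :
  fusible_elt (mfrac m s : qM) -> regular_fusible_elt m.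
Proof.
move=> [x [y []]]; have [n [t ->]] := mfracP x; have [p [v ->]] := mfracP y.
move=> /torsion_mfrac nT /torsion_free_mfrac pF.
rewrite mfracD => /mfrac_eqP [u] /(nonZd_scaleI (@denom_nonZd u)) mE.
exists (sval (denomM t v)); first exact: denom_nonZd.
rewrite mE; apply: fusible_elt_scale; first exact: denom_nonZd.
exists (sval v *: n), (sval t *: p); split=> //.
  by apply: torsion_scale nT; exact: denom_nonZd.
by apply: torsion_free_scale pF; exact: denom_nonZd.
Qed.

Lemma regular_fusible_total_quotient : regular_fusible M <-> fusible qM.
Proof.
split=> [rfM x|fqM m /eqP m0].
  have [m [s ->]] := mfracP x => /eqP ms0.
  have /eqP /rfM [r /nonZdP rS rmF] : m <> 0 by move=> /mfrac_eq0 /ms0.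
  by rewrite -(mfrac_scale_cancel m s (exist _ r rS)); exact: fusible_elt_mfrac.
apply: (@fusible_elt_mfrac_regular m denom1); apply: fqM.
by apply/eqP => /mfrac_eq0.
Qed.

End Faithful.

End TotalQuotient.

Theorem theorem2 (R : comPzRingType) (M : lmodType R) (hM : faithful M) :
  (regular_fusible M <-> fusible (total_quotient_module M)) /\
  (fusible (total_quotient_module M) <->
   regular_fusible (total_quotient_module M)).
Proof.
split; first exact: regular_fusible_total_quotient.
split; first exact: fusible_regular_fusible.
exact/regular_fusible_fusible/nonZd_total_quotient_inv.
Qed.
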